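(* Let $X$ be a locally compact Hausdorff connected space, let $\rho$ be a quasi-linear functional on $C_c(X)$ or on $C_0(X)$, and let $\mu=\mu_\rho$ be the corresponding topological measure. (i) Suppose $\mu$ is compact-finite. If $f,g\in C_c(X)$, $f,g\ge0$, and $\operatorname{supp} f,\operatorname{supp} g\subseteq K$, where $K$ is compact, then $$|\rho(f)-\rho(g)|\le\|f-g\|\,\mu(K).$$ In particular, for any $f\in C_c(X)$, $|\rho(f)|\le\|f\|\,\mu(\operatorname{supp} f)$. If $f,g\in C_c(X)$ and $\operatorname{supp} f,\operatorname{supp} g\subseteq K$, where $K$ is compact, then $$|\rho(f)-\rho(g)|\le2\|f-g\|\,\mu(K).$$ Thus, $\rho$ is continuous with respect to the topology of uniform convergence on compact sets. (ii) Suppose $\mu(X)<\infty$ (i.e. $\|\rho\|<\infty$). If $f\in C_c(X)$ then $|\rho(f)|\le\|f\|\,\mu(X)=\|f\|\,\|\rho\|$. If $f,g\in C_c(X)$ and $f,g\ge0$ then $|\rho(f)-\rho(g)|\le\|f-g\|\,\mu(X)=\|f-g\|\,\|\rho\|$. For arbitrary $f,g\in C_c(X)$, $|\rho(f)-\rho(g)|\le2\|f-g\|\,\mu(X)=2\|f-g\|\,\|\rho\|$. Thus, $\rho$ is uniformly continuous. (iii) Let $X$ be compact, and let $\rho$ be a quasi-linear functional on $C(X)$. Then for any $f,g\in C(X)$, $$|\rho(f)-\rho(g)|\le\rho(\|f-g\|)=\|f-g\|\,\rho(1),$$ where $\|f-g\|$ inside $\rho$ denotes the constant function. In particular, $\rho$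 is uniformly continuous. If $f+g=c$ is constant, then $\rho(f)+\rho(g)=\rho(c)$.
   Context: $C_0(X)$, $C_c(X)$, $C_b(X)$ are the real-valued continuous functions on $X$ vanishing at infinity, with compact support, and bounded, respectively, with the uniform norm $\|\cdot\|$ (all equal to $C(X)$ if $X$ is compact); $\operatorname{supp} f=\overline{\{f\neq0\}}$. Singly generated subalgebra: for $f\in C_b(X)$, $S(f)$ is the smallest uniformly closed subalgebra of $C_b(X)$ containing $f$ and, if $X$ is compact, also containing the constant $1$. (If $X$ is compact, $S(f)=\{\phi\circ f:\phi\in C(f(X))\}$; if $X$ is not compact and $f\in C_0(X)$ or $C_c(X)$, $S(f)=\{\phi\circ f:\phi\in C(\overline{f(X)}),\ \phi(0)=0\}$, which lies in $C_0(X)$, resp. $C_c(X)$.) Quasi-linear functional on $\mathcal B$ ($\mathcal B=C_0(X)$ or $C_c(X)$): a map $\rho:\mathcal B\to\mathbb R$ with $\rho(af)=a\rho(f)$ for $a\in\mathbb R$, $f\in\mathcal B$; $\rho(f+g)=\rho(f)+\rho(g)$ whenever $f,g\in S(h)$ for some $h\in\mathcal B$; and $\rho(f)\ge0$ whenever $f\ge0$. Its norm is $\|\rho\|=\sup\{\rho(f): f\in\mathcal B,\ 0\le f\le1\}\in[0,\infty]$. The set function $\mu_\rho$ (on open and closed subsets of $X$) is defined by $\mu_\rho(U)=\sup\{\rho(f): f\in C_c(X),\ 0\le f\le1,\ \operatorname{supp} f\subseteq U\}$ for $U$ open, and $\mu_\rho(F)=\inf\{\mu_\rho(U):F\subseteq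 U,\ U\text{ open}\}$ for $F$ closed. Compact-finite means $\mu(K)<\infty$ for every compact $K$.
   Formalization: In (i), continuity for uniform convergence on compact sets is stated on each set of f in C_c(X) with supp f in a fixed compact K; on all of C_c(X) it fails for the Lebesgue integral on the line (unit bumps moving to infinity). *)

(* Defs.v *)
From HB Require Import structures.
From mathcomp Require Import all_boot all_order all_algebra.
From mathcomp Require Import all_classical all_reals all_analysis.

Set Implicit Arguments.
Unset Strict Implicit.
Unset Printing Implicit Defensive.

Import Order.TTheory GRing.Theory Num.Theory.
Import numFieldNormedType.Exports.

Local Open Scope classical_set_scope.
Local Open Scope ring_scope.

Section FunctionSpaces.
Context {R : realType} {X : topologicalType}.
Implicit Types (f g h : X -> R) (A B : set (X -> R)).

Definition fsupp f : set X := closure [set x | f x != 0].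

Definition Cb : set (X -> R) := [set f | continuous f /\ bounded_fun f].

Definition C0 : set (X -> R) :=
  [set f | continuous f /\
           forall e : R, 0 < e -> compact [set x | e <= `|f x|]].

Definition Cc : set (X -> R) := [set f | continuous f /\ compact (fsupp f)].

(* The value is meaningful for bounded f only ([sup] of an unbounded set is 0);
   every use below is on such an f. *)
Definition unorm f : R := sup (range (fun x => `|f x|)).

(* A is closed in the space of all functions X -> R with the uniform topology.
   As Cb is closed there, this amounts to A being closed in Cb. *)
Definition closed_subalgebra A :=
  [/\ A `<=` Cb,
      A (cst 0),
      forall f g, A f -> A g -> A (f \+ g) /\ A (f \* g),
      forall (a : R) f, A f -> A (a \*: f) &
      closed (A : set {uniform X -> R})].

Definition single_gen f : set (X -> R) :=
  smallest (fun A => closed_subalgebra A /\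
                     (compact [set: X] -> A (cst 1))) [set f].

(* A functional on B is a total function rho of which only the values on B
   matter. *)
Definition quasi_linear B (rho : (X -> R) -> R) :=
  [/\ forall (a : R) f, B f -> rho (a \*: f) = a * rho f,
      forall h f g, B h -> single_gen h f -> single_gen h g ->
        rho (f \+ g) = rho f + rho g &
      forall f, B f -> (forall x, 0 <= f x) -> 0 <= rho f].

Definition qnorm B (rho : (X -> R) -> R) : \bar R :=
  ereal_sup [set (rho f)%:E | f in B `&` [set f | forall x, 0 <= f x <= 1]].

Definition mu_open (rho : (X -> R) -> R) (U : set X) : \bar R :=
  ereal_sup [set (rho f)%:E | f in
    [set f | [/\ Cc f, forall x, 0 <= f x <= 1 & fsupp f `<=` U]]].

(* Only open and closed sets matter.  By [muE_closed], on sets that are both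
   open and closed the two formulas agree. *)
Definition mu (rho : (X -> R) -> R) (A : set X) : \bar R :=
  if `[< open A >] then mu_open rho A
  else ereal_inf [set mu_open rho U | U in [set U | open U /\ A `<=` U]].

Lemma muE_open rho U : open U -> mu rho U = mu_open rho U.
Proof. by rewrite /mu => /asboolT ->. Qed.

Lemma muE_closed rho F : closed F ->
  mu rho F = ereal_inf [set mu_open rho U | U in [set U | open U /\ F `<=` U]].
Proof.
move=> _; rewrite /mu; case: asboolP => // oF.
apply/eqP; rewrite eq_le; apply/andP; split; last first.
  by apply: ereal_inf_lbound; exists F => /=; [split|].
apply: le_ereal_inf_tmp => _ [V [oV FV] <-].
apply: ge_ereal_sup => _ [f [cf f01 fF] <-].
apply: ereal_sup_ubound; exists f => //.
by split => //; exact: subset_trans FV.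
Qed.

Definition compact_finite (m : set X -> \bar R) :=
  forall K, compact K -> (m K < +oo)%E.

(* Continuity of rho for the topology of uniform convergence on compact sets,
   on each space of functions supported in a fixed compact set K, i.e. on Cc as
   the union of these spaces.  On the whole of Cc, without a common compact
   support, it already fails for the Lebesgue integral on the line. *)
Definition continuous_uc_compact (rho : {family compact, X -> R} -> R) :=
  forall K : set X, compact K ->
    {within [set f : {family compact, X -> R} | Cc f /\ fsupp f `<=` K],
      continuous rho}.

Definition unif_continuous_on (B : set {uniform X -> R})
    (rho : {uniform X -> R} -> R) :=
  unif_continuous (rho : subspace B -> R).

End FunctionSpaces.

(* Main.v *)
(* If phi 0 = 0 and phi is obtained from the identity and constants by ring
   operations and |.|, then phi o h lies in S(h).  The heart of the matter is
   that rho is monotone on nonnegative functions although f <= g need not lie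
   in a common S(h): slice f and g at the heights e, 2e, 3e, ...; the (i+1)st
   slice of f lives where the ith slice of g equals its maximum e, and two such
   functions are both truncations of their sum, so rho is ordered on them.
   Hence rho ((f - e)^+) <= rho g, and e -> 0 because
   rho (min (f, d^2)) <= d rho (sqrt f).
   Given f <= g + c on a compact K containing the supports, take w in Cc with
   w = 1 on K and supp w in U; then f <= g + c w, and g, w lie in a common S(h)
   because w = 1 on supp g, so rho f <= rho g + c rho w <= rho g + c mu(U).
   Signed functions split as f^+ - f^- inside S(f); C0 is reached from Cc by
   f |-> (f - e)^+; if X is compact, constants lie in S(g) and play the role
   of w. *)

Require Import Defs.
From HB Require Import structures.
From mathcomp Require Import all_boot all_order all_algebra.
From mathcomp Require Import all_classical all_reals all_analysis.
From mathcomp Require Import ring lra.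

Set Implicit Arguments.
Unset Strict Implicit.
Unset Printing Implicit Defensive.

Import Order.TTheory GRing.Theory Num.Theory.
Import numFieldNormedType.Exports.

Local Open Scope classical_set_scope.
Local Open Scope ring_scope.

(** * Functions that operate on closed subalgebras *)

Section ClosedSubalgebra.
Context {R : realType} {X : topologicalType}.
Implicit Types (f g h : X -> R) (A : set (X -> R)) (phi psi : R -> R).

Lemma bounded_funE f :
  bounded_fun f <-> exists2 M, 0 < M & forall x, `|f x| <= M.
Proof.
split=> [[M [_ fM]]|[M M0 fM]].
  exists (`|M| + 1) => [|x]; first by rewrite ltr_wpDl.
  by apply: fM => //; rewrite (le_lt_trans (ler_norm M))// ltrDl.
by exists M; split=> [|N /ltW MN x _]; [exact: gtr0_real|exact: le_trans MN].
Qed.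

(** The epsilon form of closedness. The limit [f] is an arbitrary function, since [A] is closed
    among all functions with the uniform topology. *)
Lemma closed_subalgebra_lim A f : closed_subalgebra A ->
  (forall e, 0 < e -> exists2 g, A g & forall x, `|f x - g x| < e) -> A f.
Proof.
move=> [_ _ _ _ clA] Af; apply: clA => W /uniform_nbhs[E [+ sEW]].
rewrite -entourage_ballE => -[e /= e0 sE].
have [g Ag fg] := Af _ e0.
by exists g; split=> //; apply: sEW => x _; apply: sE; exact: fg.
Qed.

(* The shift by [phi 0] is needed because A may fail to contain constants. *)
Definition operates phi :=
  forall A h, closed_subalgebra A -> A h -> A (fun x => phi (h x) - phi 0).

Lemma operates_id : operates id.
Proof.
by move=> A h _ Ah; rewrite (_ : (fun _ => _) = h)//; apply/funext => x;
  rewrite subr0.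
Qed.

Lemma operates_cst c : operates (cst c).
Proof.
move=> A h [_ A0 _ _ _] _; rewrite (_ : (fun _ => _) = cst 0)//.
by apply/funext => x; rewrite subrr.
Qed.

Lemma operatesZ a phi : operates phi -> operates (fun t => a * phi t).
Proof.
move=> Aphi A h cA Ah; have [_ _ _ AZ _] := cA.
have := AZ a _ (Aphi A h cA Ah); congr A.
by apply/funext => x /=; rewrite /GRing.scale/= mulrBr.
Qed.

Lemma operatesD phi psi :
  operates phi -> operates psi -> operates (fun t => phi t + psi t).
Proof.
move=> Aphi Apsi A h cA Ah; have [_ _ AD _ _] := cA.
have [+ _] := AD _ _ (Aphi A h cA Ah) (Apsi A h cA Ah); congr A.
by apply/funext => x /=; ring.
Qed.

Lemma operatesB phi psi :
  operates phi -> operates psi -> operates (fun t => phi t - psi t).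
Proof.
move=> Aphi /(operatesZ (-1)) /(operatesD Aphi).
by congr operates; apply/funext => x; rewrite mulN1r.
Qed.

(** With [p = phi 0] and [q = psi 0], the shifted product is [(phi - p)(psi - q) + p (psi - q) + q
    (phi - p)], a sum of terms already in [A]. *)
Lemma operatesM phi psi :
  operates phi -> operates psi -> operates (fun t => phi t * psi t).
Proof.
move=> Aphi Apsi A h cA Ah; have [_ _ AD AZ _] := cA.
have A1 := Aphi A h cA Ah; have A2 := Apsi A h cA Ah.
have [_ A3] := AD _ _ A1 A2.
have [A4 _] := AD _ _ A3 (AZ (phi 0) _ A2).
have [+ _] := AD _ _ A4 (AZ (psi 0) _ A1); congr A.
by apply/funext => x /=; rewrite /GRing.scale/=; ring.
Qed.

(** The classical polynomial iteration that increases to the square root of [t^2] on [[-1, 1]]. *)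
Fixpoint abs_approx (n : nat) (t : R) : R :=
  if n is n'.+1 then
    abs_approx n' t + 2^-1 * (t * t - abs_approx n' t * abs_approx n' t)
  else 0.

(** One step turns the error [e = |t| - p] into [e - e (|t| + p) / 2], which is at most
    [e - e^2 / 2] because [p >= 0]. *)
Lemma abs_approxP n (t : R) : `|t| <= 1 ->
  0 <= abs_approx n t <= `|t| /\ `|t| - abs_approx n t <= 2 / n.+2%:R.
Proof.
move=> t1; have t0 := normr_ge0 t.
have tt : t * t = `|t| * `|t| by rewrite -normrM ger0_norm ?sqr_ge0.
elim: n => [|n [/andP[p0 pt] ptn]] /=.
  by rewrite lexx t0 subr0 divff// pnatr_eq0.
set p := abs_approx n t in p0 pt ptn *; rewrite tt; move: `|t| t0 t1 pt ptn.
move=> s s0 s1 ps psn; split; first by apply/andP; split; nra.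
set m : R := n.+2%:R in psn *; have m2 : 2 <= m by rewrite ler_nat.
have -> : n.+3%:R = m + 1 :> R by rewrite -natr1.
set e := s - p in psn *; set b := 2 / m in psn.
have mb : m * b = 2 by rewrite /b mulrCA divff ?mulr1//; lra.
have b1 : b <= 1 by nra.
have -> : s - (p + 2^-1 * (s * s - p * p)) = e - 2^-1 * (e * (s + p)).
  by rewrite /e; ring.
have e0 : 0 <= e by rewrite /e; lra.
have he : e - 2^-1 * (e * (s + p)) <= e - 2^-1 * (e * e).
  by rewrite /e; nra.
(* The map [s - s^2 / 2] increases on [[0, 1]], so the old bound [b = 2 / m] may replace [e]; then
   [b - b^2 / 2 <= 2 / (m + 1)]. *)
have be : e - 2^-1 * (e * e) <= b - 2^-1 * (b * b) by nra.
apply: (le_trans he); apply: (le_trans be).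
rewrite ler_pdivlMr; last by lra.
have : b * (m + 1) = 2 + b by rewrite mulrDr mulrC mb mulr1.
nra.
Qed.

Lemma operates_abs_approx n phi :
  operates phi -> operates (fun t => abs_approx n (phi t)).
Proof.
move=> Aphi; elim: n => [|n IH] /=; first exact: operates_cst.
by apply: operatesD => //; apply: operatesZ; apply: operatesB; exact: operatesM.
Qed.

(** After rescaling, [|phi o h|] is a uniform limit of polynomials in [phi o h]. *)
Lemma operates_norm phi : operates phi -> operates (fun t => `|phi t|).
Proof.
move=> Aphi A h cA Ah; have [ACb _ _ _ _] := cA.
have [_ /bounded_funE[M M0 hM]] := ACb _ (Aphi A h cA Ah).
(* [M] bounds only the shifted function; [N] bounds both [phi o h] and [phi 0], so dividing by [N]
   lands in [[-1, 1]]. *)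
pose N := M + `|phi 0|; have N0 : 0 < N by rewrite ltr_wpDr.
have phiN x : `|phi (h x)| <= N.
  by rewrite -(subrK (phi 0) (phi _)) (le_trans (ler_normD _ _))// lerD2r.
have phi0N : `|phi 0| <= N by rewrite lerDr ltW.
clearbody N.
pose psi t := N^-1 * phi t.
have psi1 t : `|phi t| <= N -> `|psi t| <= 1.
  move=> tN; rewrite /psi normrM gtr0_norm ?invr_gt0//.
  by rewrite mulrC ler_pdivrMr// mul1r.
have phiE t : `|phi t| = N * `|psi t|.
  by rewrite /psi normrM gtr0_norm ?invr_gt0// mulrA divff ?mul1r// gt_eqF.
have Apsi : operates psi by exact: operatesZ.
apply: closed_subalgebra_lim => // e e0.
(* The errors at [psi (h x)] and at [psi 0] both lie in [[0, 2 / n.+2%:R]], hence so does the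
   modulus of their difference; any [n] above [4 * N / e] makes [N] times this smaller than [e]. *)
have [n nP] : exists n : nat, 4 * N / e < n%:R.
  exists (Num.truncn (4 * N / e)).+1; exact: truncnS_gt.
exists (fun x => N * abs_approx n (psi (h x)) - N * abs_approx n (psi 0)).
  by apply: (operatesZ N (operates_abs_approx n Apsi)).
move=> x; rewrite !phiE.
have [/andP[a0 a1] a2] := abs_approxP n (psi1 _ (phiN x)).
have [/andP[b0 b1] b2] := abs_approxP n (psi1 _ phi0N).
rewrite -[ltLHS]/(`|_|) [X in `|X|](_ : _ =
  N * ((`|psi (h x)| - abs_approx n (psi (h x))) -
       (`|psi 0| - abs_approx n (psi 0)))); last by ring.
rewrite normrM (gtr0_norm N0).
have dn : N * (2 / n.+2%:R) < e.
  rewrite mulrA ltr_pdivrMr//; move: nP; rewrite ltr_pdivrMr// => nP.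
  have nn : n%:R * e <= n.+2%:R * e.
    by rewrite ler_pM2r// ler_nat -addn2 leq_addr.
  by rewrite [ltRHS]mulrC; apply: lt_le_trans nn; apply: le_lt_trans nP;
  by rewrite [leLHS]mulrC ler_pM2r ?ler_nat.
apply: le_lt_trans dn; rewrite ler_pM2l// ler_norml.
move: a1 a2 b1 b2; set q := 2 / _ => *; apply/andP; split; lra.
Qed.

Lemma operates_max phi psi :
  operates phi -> operates psi -> operates (fun t => Num.max (phi t) (psi t)).
Proof.
move=> Aphi Apsi; have := operatesZ 2^-1
  (operatesD (operatesD Aphi Apsi) (operates_norm (operatesB Aphi Apsi))).
by congr operates; apply/funext => t; rewrite maxr_absE mulrC.
Qed.

Lemma operates_min phi psi :
  operates phi -> operates psi -> operates (fun t => Num.min (phi t) (psi t)).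
Proof.
move=> Aphi Apsi.
have := operatesB (operatesD Aphi Apsi) (operates_max Aphi Apsi).
congr operates; apply/funext => t; apply/eqP.
by rewrite subr_eq eq_sym addr_min_max.
Qed.

(** [S(f)] is never described explicitly: the composition is placed in every competing subalgebra at
    once, and [phi 0 = 0] removes the shift. *)
Lemma single_gen_comp phi f :
  operates phi -> phi 0 = 0 -> single_gen f (phi \o f).
Proof.
move=> Aphi phi0 A [[cA _] fA]; have := Aphi A f cA (fA f erefl).
by congr A; apply/funext => x /=; rewrite phi0 subr0.
Qed.

Lemma single_gen_id f : single_gen f f.
Proof. by move=> A [_ fA]; exact: fA. Qed.

Lemma single_genD h f g :
  single_gen h f -> single_gen h g -> single_gen h (f \+ g).
Proof.
move=> hf hg A hA; have [[[_ _ AD _ _] _] _] := hA.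
by have [] := AD _ _ (hf A hA) (hg A hA).
Qed.

Lemma single_genZ h a f : single_gen h f -> single_gen h (a \*: f).
Proof.
by move=> hf A hA; have [[[_ _ _ AZ _] _] _] := hA; exact: AZ (hf A hA).
Qed.

Lemma single_gen_cst h a : compact [set: X] -> single_gen h (cst a).
Proof.
move=> cX A hA; have [[[_ _ _ AZ _] A1] _] := hA.
have := AZ a _ (A1 cX); congr A.
by apply/funext => x /=; rewrite /GRing.scale/= mulr1.
Qed.

End ClosedSubalgebra.

(** * Closure properties common to [Cc] and [C0] *)

Section FunctionClasses.
Context {R : realType} {X : topologicalType}.
Implicit Types (f g h : X -> R) (B : set (X -> R)).

Lemma scale_funE a f x : (a \*: f) x = a * f x.
Proof. by []. Qed.

Lemma continuous_minr f g : continuous f -> continuous g ->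
  continuous (fun x => Num.min (f x) (g x)).
Proof.
by move=> cf cg x; apply: (@continuous_min R X f g x); [exact: cf|exact: cg].
Qed.

Lemma continuous_maxr f g : continuous f -> continuous g ->
  continuous (fun x => Num.max (f x) (g x)).
Proof.
by move=> cf cg x; apply: (@continuous_max R X f g x); [exact: cf|exact: cg].
Qed.

Lemma continuousDr f g : continuous f -> continuous g -> continuous (f \+ g).
Proof.
by move=> cf cg x; apply: (@continuousD R R^o X f g x); [exact: cf|exact: cg].
Qed.

Lemma continuousZr a f : continuous f -> continuous (a \*: f).
Proof.
by move=> cf x; apply: (@continuousM R X (cst a) f x);
  [exact: cst_continuous|exact: cf].
Qed.

Lemma continuous_cstr (a : R) : continuous (cst a : X -> R).
Proof. by move=> x; exact: cst_continuous. Qed.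

Lemma continuous_sqrt f : continuous f -> continuous (fun x => Num.sqrt (f x)).
Proof.
move=> cf x; apply: (@continuous_comp _ _ _ f Num.sqrt); first exact: cf.
exact: sqrt_continuous.
Qed.

Lemma closed_norm_ge f e : continuous f -> closed [set x | e <= `|f x|].
Proof.
move=> cf; have cn : continuous (fun x => `|f x|).
  by move=> x; apply: (@continuous_comp _ _ _ f (fun t : R => `|t|));
    [exact: cf|exact: norm_continuous].
exact: ((continuous_closedP _).1 cn _ (@closed_ge R e)).
Qed.

Lemma sub_fsupp f x : f x != 0 -> fsupp f x.
Proof. by move=> fx; apply: subset_closure. Qed.

Lemma fsupp_out f x : ~ fsupp f x -> f x = 0.
Proof. by move=> nfx; apply/eqP/negPn/negP => /sub_fsupp. Qed.

Lemma fsupp_subP f (F : set X) : closed F ->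
  (forall x, f x != 0 -> F x) -> fsupp f `<=` F.
Proof. by move=> /closure_id cF fF; rewrite cF; apply: closureS. Qed.

Lemma CcC0 : (Cc : set (X -> R)) `<=` C0.
Proof.
move=> f [cf kf]; split=> // e e0; apply: (subclosed_compact _ kf).
  exact: closed_norm_ge.
by move=> x /= ex; apply: sub_fsupp; rewrite -normr_gt0 (lt_le_trans e0).
Qed.

Lemma compact_CcE : compact [set: X] ->
  (Cc : set (X -> R)) = [set f | continuous f].
Proof.
move=> cX; apply/seteqP; split=> [f []//|f cf]; split=> //.
exact: (subclosed_compact (@closed_closure _ _) cX).
Qed.

Definition Cc_or_C0 B := B = Cc \/ B = C0.

Lemma Cc_or_C0_sub B : Cc_or_C0 B -> B `<=` C0.
Proof. by case=> ->//; exact: CcC0. Qed.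

Lemma Cc_sub B : Cc_or_C0 B -> Cc `<=` B.
Proof. by case=> ->//; exact: CcC0. Qed.

Lemma Cc_or_C0_continuous B f : Cc_or_C0 B -> B f -> continuous f.
Proof. by move=> /Cc_or_C0_sub BC0 /BC0[]. Qed.

(** A continuous function is bounded on the compact set where [|f| >= 1], and by 1 elsewhere. *)
Lemma C0_bounded f : C0 f -> exists2 M, 0 < M & forall x, `|f x| <= M.
Proof.
move=> [cf kf]; have := kf 1 ltr01.
move=> /(@continuous_compact _ _ f _ (continuous_subspaceT cf)).
move=> /(@compact_bounded R R^o)[M [_ fM]].
exists (`|M| + 1) => [|x]; first by rewrite ltr_wpDl.
have [fx1|/ltW fx1] := leP 1 `|f x|; last first.
  by rewrite (le_trans fx1)// lerDr.
by apply: fM; [rewrite (le_lt_trans (ler_norm M))// ltrDl|exists x].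
Qed.

(** A single criterion for both spaces. The level [d] may depend on [e] in any way, which admits the
    square root with [d = e ^+ 2]. *)
Lemma dominated_in B f g h : Cc_or_C0 B -> B f -> B g -> continuous h ->
  (forall e, 0 < e -> exists2 d, 0 < d &
    forall x, e <= `|h x| -> d <= `|f x| \/ d <= `|g x|) -> B h.
Proof.
move=> [->|->] [cf kf] [cg kg] ch hfg; split=> //.
  have kfg := compactU kf kg; apply: (subclosed_compact _ kfg).
    exact: closed_closure.
  apply: fsupp_subP => [|x hx].
    by apply: closedU; exact: closed_closure.
  have [|d d0 /(_ x (lexx _))[] dx] := hfg `|h x|; first by rewrite normr_gt0.
    by left; apply: sub_fsupp; rewrite -normr_gt0 (lt_le_trans d0).
  by right; apply: sub_fsupp; rewrite -normr_gt0 (lt_le_trans d0).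
move=> e e0; have [d d0 hd] := hfg e e0.
apply: (subclosed_compact _ (compactU (kf d d0) (kg d d0))) => //.
exact: closed_norm_ge.
Qed.

Lemma inD B f g : Cc_or_C0 B -> B f -> B g -> B (f \+ g).
Proof.
move=> HB Bf Bg; apply: (dominated_in HB Bf Bg).
  by apply: continuousDr; exact: Cc_or_C0_continuous HB _.
move=> e e0; exists (e / 2) => [|x /= efg]; first by rewrite divr_gt0.
have := ler_normD (f x) (g x).
have [?|?] := leP (e / 2) `|f x|; [by left|move=> ?; right; lra].
Qed.

Lemma inZ B a f : Cc_or_C0 B -> B f -> B (a \*: f).
Proof.
move=> HB Bf; apply: (dominated_in HB Bf Bf).
  by apply: continuousZr; exact: Cc_or_C0_continuous HB _.
have a1 : 0 < `|a| + 1 by rewrite ltr_wpDl.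
move=> e e0; exists (e / (`|a| + 1)) => [|x]; first by rewrite divr_gt0.
rewrite /= normrM => eaf; left; rewrite ler_pdivrMr// (le_trans eaf)//.
by rewrite mulrC ler_wpM2l// lerDl.
Qed.

Lemma in_le B f h : Cc_or_C0 B -> B f -> continuous h ->
  (forall x, `|h x| <= `|f x|) -> B h.
Proof.
move=> HB Bf ch hf; apply: (dominated_in HB Bf Bf ch) => e e0.
by exists e => // x eh; left; exact: le_trans (hf x).
Qed.

Lemma in_sqrt B f : Cc_or_C0 B -> B f -> B (fun x => Num.sqrt (f x)).
Proof.
move=> HB Bf; apply: (dominated_in HB Bf Bf).
  by apply: continuous_sqrt; exact: Cc_or_C0_continuous HB _.
move=> e e0; exists (e ^+ 2) => [|x]; first by rewrite exprn_gt0.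
rewrite ger0_norm ?sqrtr_ge0// => ef; left.
apply: le_trans (ler_norm _).
(* For negative [f x] the square root is 0 by convention, against [0 < e]. *)
have [f0|f0] := leP 0 (f x); last first.
  by move: ef; rewrite (ler0_sqrtr (ltW f0)) leNgt e0.
by rewrite -(sqr_sqrtr f0) ler_sqr ?nnegrE ?sqrtr_ge0// ltW.
Qed.

(** * Cutting a function at a height *)

Definition trunc (c : R) f x := Num.min (f x) c.
Definition excess (c : R) f x := Num.max (f x - c) 0.

Lemma trunc_excess c f : trunc c f \+ excess c f = f.
Proof.
apply/funext => x /=; rewrite /trunc /excess.
by case: (leP (f x) c) => fc; case: (leP (f x - c) 0) => ?; lra.
Qed.

Lemma truncP c f x : 0 <= f x -> 0 <= c ->
  [/\ 0 <= trunc c f x, trunc c f x <= c & trunc c f x <= f x].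
Proof.
by move=> f0 c0; rewrite /trunc; case: (leP (f x) c) => ?; split; lra.
Qed.

Lemma excess_ge0 c f x : 0 <= excess c f x.
Proof. by rewrite /excess; case: (leP (f x - c) 0) => ?; lra. Qed.

Lemma excess_neq0 c f x : excess c f x != 0 -> c < f x.
Proof.
by rewrite /excess; case: (leP (f x - c) 0) => [|?]; rewrite ?eqxx//; lra.
Qed.

Lemma excess_le c f x : 0 <= f x -> 0 <= c -> excess c f x <= f x.
Proof. by rewrite /excess; case: (leP (f x - c) 0) => ?; lra. Qed.

Lemma continuous_trunc c f : continuous f -> continuous (trunc c f).
Proof. by move=> cf; apply: continuous_minr => //; exact: continuous_cstr. Qed.

Lemma continuous_excess c f : continuous f -> continuous (excess c f).
Proof.
move=> cf; apply: continuous_maxr; last exact: continuous_cstr.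
by apply: (@continuousDr f (cst (- c))) => //; exact: continuous_cstr.
Qed.

Lemma in_trunc B c f : Cc_or_C0 B -> B f -> (forall x, 0 <= f x) -> 0 <= c ->
  B (trunc c f).
Proof.
move=> HB Bf f0 c0; apply: (in_le HB Bf).
  by apply: continuous_trunc; exact: Cc_or_C0_continuous HB Bf.
by move=> x; have [? _ ?] := truncP (f0 x) c0; rewrite !ger0_norm.
Qed.

Lemma in_excess B c f : Cc_or_C0 B -> B f -> (forall x, 0 <= f x) -> 0 <= c ->
  B (excess c f).
Proof.
move=> HB Bf f0 c0; apply: (in_le HB Bf).
  by apply: continuous_excess; exact: Cc_or_C0_continuous HB Bf.
by move=> x; rewrite !ger0_norm ?excess_ge0// excess_le.
Qed.

(** The passage from [C0] to [Cc]: the support lies in the compact set where [|f| >= c]. *)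
Lemma Cc_excess c f : C0 f -> 0 < c -> Cc (excess c f).
Proof.
move=> [cf kf] c0; split; first exact: continuous_excess.
apply: (subclosed_compact _ (kf c c0)); first exact: closed_closure.
apply: fsupp_subP => [|x /excess_neq0 cfx]; first exact: closed_norm_ge.
by rewrite /= (le_trans (ltW cfx))// ler_norm.
Qed.

Lemma unorm_ub f x : (exists2 M, 0 < M & forall y, `|f y| <= M) ->
  `|f x| <= unorm f.
Proof.
move=> [M _ fM]; apply: ub_le_sup; last by exists x.
by exists M => _ [y _ <-].
Qed.

(** For empty [X] or unbounded [f] the value is the default 0 of [sup]. *)
Lemma unorm_ge0 f : 0 <= unorm f.
Proof.
have [[[_ [x _ _]] ub]|nhs] := pselect (has_sup (range (fun x => `|f x|)));
  last by rewrite /unorm sup_out.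
by apply: (@le_trans _ _ `|f x|) => //; apply: ub_le_sup => //; exists x.
Qed.

Lemma C0_sub_bounded f g : C0 f -> C0 g ->
  exists2 M, 0 < M & forall x, `|(f \- g) x| <= M.
Proof.
move=> /C0_bounded[M M0 fM] /C0_bounded[N N0 gN]; exists (M + N).
  exact: addr_gt0.
by move=> x /=; rewrite (le_trans (ler_normB _ _))// lerD.
Qed.

End FunctionClasses.

(** * Compactly supported Urysohn functions *)

Section Urysohn.
Context {R : realType} {X : topologicalType}.
Hypotheses (lcX : locally_compact [set: X]) (hX : hausdorff_space X).

(** A filter pushed forward along [Some] clusters at a point of [C], which is not [None]; images
    under [Some] of neighbourhoods are neighbourhoods, so the point is a cluster point in [X]. *)
Lemma compact_preimage_some (C : set (one_point_compactification X)) :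
  closed C -> ~ C None -> compact (Some @^-1` C : set X).
Proof.
move=> clC CN F PF FC.
have kC : compact C.
  by apply: (subclosed_compact clC one_point_compactification_compact).
have [[x|] [Cx Fx]] := kC (Some @ F) _ FC; last by [].
exists x; split=> // V W FV Wx.
have [|y [Vy [z Wz zy]]] := Fx (Some @` V) (Some @` W) _
    (@one_point_compactification_some_nbhs _ _ _ Wx).
  by apply: (@filterS _ F _ V _ _ FV) => z Vz; exists z.
by case: Vy zy => t Vt <- [zt]; exists t; split=> //; rewrite -zt.
Qed.

(** The one-point compactification is compact Hausdorff, hence normal, and separation takes place
    there, between the image of [K] and the complement of the image of [U]. *)
Lemma urysohn_Cc (K U : set X) : compact K -> open U -> K `<=` U ->
  exists w : X -> R, [/\ Cc w, forall x, 0 <= w x <= 1,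
    forall x, K x -> w x = 1 & fsupp w `<=` U].
Proof.
move=> kK oU KU; pose Y := one_point_compactification X.
have hY : hausdorff_space Y by exact: one_point_compactification_hausdorff.
have nY : normal_space Y.
  exact: (compact_normal hY one_point_compactification_compact).
have cS : continuous (Some : X -> Y).
  exact: one_point_compactification_some_continuous.
have clK : closed (Some @` K : set Y).
  apply: compact_closed => //; apply: continuous_compact => //.
  exact: continuous_subspaceT.
have clU : closed (~` (Some @` U) : set Y).
  exact/open_closedC/one_point_compactification_open_some.
have dUK : ~` (Some @` U) `&` (Some @` K) = set0 :> set Y.
  apply/disjoints_subset => y nUy [x Kx xy]; apply: nUy.
  by exists x => //; exact: KU.
have /(@uniform_separatorP Y R)[v [cv v01 v0 v1]] :=
  (@normal_separatorP R Y).1 nY _ _ clU clK dUK.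
pose g : X -> R := v \o Some.
have g01 x : 0 <= g x <= 1.
  by have := v01 (g x); rewrite /= in_itv/=; apply; exists (Some x).
have gK x : K x -> g x = 1.
  by move=> Kx; apply: v1; exists (Some x) => //; exists x.
have cg : continuous g.
  by move=> x; apply: (@continuous_comp _ _ _ (Some : X -> Y) v);
    [exact: cS|exact: cv].
pose C : set Y := v @^-1` [set t | 2^-1 <= t].
have clC : closed C by exact: ((continuous_closedP _).1 cv _ (@closed_ge R _)).
have CU y : C y -> (Some @` U) y.
  move=> Cy; apply: contrapT => nUy; have vy : v y = 0 by apply: v0; exists y.
  by move: Cy; rewrite /C /= vy leNgt invr_gt0 ltr0n.
(* Cutting at height 1/2 moves the support into the closed set [v >= 1/2], which lies in the image
   of [U] and so misses [None]; doubling restores the value 1 on [K]. *)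
pose w := 2 \*: excess 2^-1 g.
have kC : compact (Some @^-1` C : set X).
  by apply: compact_preimage_some => // /CU[].
have wC : fsupp w `<=` Some @^-1` C.
  apply: fsupp_subP; first exact: ((continuous_closedP _).1 cS).
  move=> x; rewrite /w scale_funE => wx;
  have /excess_neq0/ltW// : excess 2^-1 g x != 0.
  by apply: contra_neq wx => ->; rewrite mulr0.
exists w; split.
- split; last exact: (subclosed_compact (@closed_closure _ _) kC).
  by apply: continuousZr; exact: continuous_excess.
- move=> x; have /andP[g0 g1] := g01 x.
  by rewrite /w scale_funE /excess;
    case: (leP (g x - 2^-1) 0) => ?; apply/andP; split; lra.
- move=> x /gK gx; rewrite /w scale_funE /excess gx.
  by case: (leP (1 - 2^-1 : R) 0) => ?; lra.
- by move=> x /wC /CU[y Uy [<-]].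
Qed.

End Urysohn.

(** * Monotonicity of a quasi-linear functional *)

Section QuasiLinear.
Context {R : realType} {X : topologicalType}.
Variables (B : set (X -> R)) (rho : (X -> R) -> R).
Hypotheses (HB : Cc_or_C0 B) (Hrho : quasi_linear B rho).
Implicit Types (f g h v w : X -> R).

Lemma rhoZ a f : B f -> rho (a \*: f) = a * rho f.
Proof. by have [+ _ _] := Hrho; exact. Qed.

Lemma rhoD h f g : B h -> single_gen h f -> single_gen h g ->
  rho (f \+ g) = rho f + rho g.
Proof. by have [_ + _] := Hrho; exact. Qed.

Lemma rho_ge0 f : B f -> (forall x, 0 <= f x) -> 0 <= rho f.
Proof. by have [_ _] := Hrho; exact. Qed.

Lemma rho0 f : B f -> rho (cst 0) = 0.
Proof.
move=> Bf; rewrite (_ : cst 0 = 0 \*: f) ?rhoZ ?mul0r//.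
by apply/funext => x; rewrite scale_funE mul0r.
Qed.

Lemma rhoB h f g : B h -> B g -> single_gen h f -> single_gen h g ->
  rho (f \+ (-1) \*: g) = rho f - rho g.
Proof.
move=> Bh Bg hf hg; rewrite (rhoD Bh hf (single_genZ (-1) hg)).
by rewrite rhoZ// mulN1r.
Qed.

Lemma operates_trunc (c : R) : @operates R X (fun t => Num.min t c).
Proof. by apply: operates_min; [exact: operates_id|exact: operates_cst]. Qed.

Lemma operates_excess (c : R) : @operates R X (fun t => Num.max (t - c) 0).
Proof.
apply: operates_max; last exact: operates_cst.
by apply: operatesB; [exact: operates_id|exact: operates_cst].
Qed.

Lemma single_gen_trunc c f : 0 <= c -> single_gen f (trunc c f).
Proof.
move=> c0; apply: (@single_gen_comp _ _ (fun t => Num.min t c)).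
  exact: operates_trunc.
by rewrite min_l.
Qed.

Lemma single_gen_excess c f : 0 <= c -> single_gen f (excess c f).
Proof.
move=> c0; apply: (@single_gen_comp _ _ (fun t => Num.max (t - c) 0)).
  exact: operates_excess.
by rewrite sub0r max_r// oppr_le0.
Qed.

(* [f] and [v] are recovered from [f \+ v] by cutting it at height [c]. *)
Lemma plateau_single_gen c f v : 0 <= c -> (forall x, 0 <= f x) ->
  (forall x, 0 <= v x <= c) -> (forall x, f x != 0 -> v x = c) ->
  single_gen (f \+ v) f /\ single_gen (f \+ v) v.
Proof.
move=> c0 f0 vc fv.
have := @single_gen_trunc c (f \+ v) c0.
have := @single_gen_excess c (f \+ v) c0.
have -> : excess c (f \+ v) = f.
  apply/funext => x; have := f0 x; have /andP[] := vc x; rewrite /excess /=.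
  have [->|/fv->] := eqVneq (f x) 0.
    by move=> *; rewrite max_r//; lra.
  by move=> *; rewrite max_l//; lra.
have -> : trunc c (f \+ v) = v.
  apply/funext => x; have := f0 x; have /andP[] := vc x; rewrite /trunc /=.
  have [->|/fv->] := eqVneq (f x) 0.
    by move=> *; rewrite min_l//; lra.
  by move=> *; rewrite min_r//; lra.
by [].
Qed.

(** Both functions lie in [S(f + v)], so [rho v - rho f = rho (v - f)], and [v - f >= 0] because
    [f <= c = v] wherever [f] is nonzero. *)
Lemma rho_plateau_le c f v : B f -> B v -> 0 <= c ->
  (forall x, 0 <= f x <= c) ->
  (forall x, 0 <= v x <= c) -> (forall x, f x != 0 -> v x = c) ->
  rho f <= rho v.
Proof.
move=> Bf Bv c0 f0c vc fv.
have f0 x : 0 <= f x by have /andP[] := f0c x.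
have [Sf Sv] := plateau_single_gen c0 f0 vc fv.
rewrite -subr_ge0 -(rhoB (inD HB Bf Bv))//; apply: rho_ge0.
  by apply: inD => //; exact: inZ.
move=> x /=; rewrite scaleN1r subr_ge0.
have [->|/fv->] := eqVneq (f x) 0; first by have /andP[] := vc x.
by have /andP[] := f0c x.
Qed.

Lemma rho_trunc_excess c f : B f -> (forall x, 0 <= f x) -> 0 <= c ->
  rho f = rho (trunc c f) + rho (excess c f).
Proof.
move=> Bf f0 c0; rewrite -{1}(trunc_excess c f).
by apply: (rhoD Bf); [exact: single_gen_trunc|exact: single_gen_excess].
Qed.

(** Induction on the number of slices of height [e] that cover the range of [f]. Dropping the lowest
    slice of [f] shifts its slices by one against those of [g]. *)
Lemma rho_excess_le_of_bound n e f g : 0 < e -> B f -> B g ->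
  (forall x, 0 <= f x <= g x) -> (forall x, f x <= e *+ n.+1) ->
  rho (excess e f) <= rho g.
Proof.
move=> e0; elim: n f g => [|n IH] f g Bf Bg fg fn.
  have -> : excess e f = cst 0.
    apply/funext => x; rewrite /excess max_r// subr_le0.
    by have := fn x; rewrite mulr1n.
  rewrite (rho0 Bf); apply: rho_ge0 => // x.
  by have /andP[f0 fgx] := fg x; exact: le_trans fgx.
have f0 x : 0 <= f x by have /andP[] := fg x.
have g0 x : 0 <= g x by have /andP[_] := fg x; exact: le_trans (f0 x).
have e0' := ltW e0.
have Bf' := in_excess HB Bf f0 e0'; have Bg' := in_excess HB Bg g0 e0'.
have f'0 x := excess_ge0 e f x.
rewrite (rho_trunc_excess Bf' f'0 e0') (rho_trunc_excess Bg g0 e0').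
apply: lerD.
  (* Lowest slices: where that of [excess e f] is nonzero, [g >= f > e], so that of [g] has reached
     [e]. *)
  apply: (@rho_plateau_le e) => //.
  - exact: in_trunc.
  - exact: in_trunc.
  - by move=> x; have [-> -> _] := truncP (f'0 x) e0'.
  - by move=> x; have [-> -> _] := truncP (g0 x) e0'.
  - move=> x tx; have /excess_neq0 efx : excess e f x != 0.
      apply: contra_neq tx => fx0; rewrite /trunc fx0 min_l//.
    have /andP[_ fgx] := fg x.
    by rewrite /trunc min_r// (le_trans (ltW efx)).
(* The remainders [(f - e)^+ <= (g - e)^+] need one slice fewer. *)
apply: IH => // x.
  have /andP[_ fgx] := fg x; rewrite f'0 /= /excess.
  by case: (leP (f x - e) 0) => ?; case: (leP (g x - e) 0) => ?; lra.
rewrite /excess; have := fn x; rewrite mulrS => ?.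
have : 0 <= e *+ n.+1 by rewrite mulrn_wge0.
by case: (leP (f x - e) 0) => ? ?; lra.
Qed.

Lemma rho_excess_le e f g : 0 < e -> B f -> B g ->
  (forall x, 0 <= f x <= g x) -> rho (excess e f) <= rho g.
Proof.
move=> e0 Bf Bg fg; have [M M0 fM] := C0_bounded (Cc_or_C0_sub HB Bf).
apply: (@rho_excess_le_of_bound (Num.truncn (M / e))) => // x.
rewrite (le_trans (ler_norm _))// (le_trans (fM x))//.
by rewrite -mulr_natl -ler_pdivrMr// ltW// truncnS_gt.
Qed.

(* In the algebra of [sqrt f], [min f d^2 <= d * sqrt f]. *)
Lemma rho_trunc_le d f : 0 <= d -> B f -> (forall x, 0 <= f x) ->
  rho (trunc (d ^+ 2) f) <= d * rho (fun x => Num.sqrt (f x)).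
Proof.
move=> d0 Bf f0; set h := fun x => _.
have Bh : B h by exact: in_sqrt.
have Bt : B (trunc (d ^+ 2) f) by apply: in_trunc => //; exact: sqr_ge0.
pose phi (t : R) := Num.min t d * Num.min t d.
have ophi : @operates R X phi by apply: operatesM; exact: operates_trunc.
have phiE : trunc (d ^+ 2) f = phi \o h.
  apply/funext => x /=; rewrite /phi /trunc /h.
  have s0 := sqrtr_ge0 (f x); rewrite -{1}(sqr_sqrtr (f0 x)).
  move: (Num.sqrt (f x)) s0 => s s0.
  have [sd|ds] := leP s d.
    by rewrite min_l ?ler_sqr// expr2.
  by rewrite min_r ?ler_sqr ?nnegrE// ?ltW// expr2.
have St : single_gen h (trunc (d ^+ 2) f).
  rewrite phiE; apply: single_gen_comp => //.
  by rewrite /phi min_l// mulr0.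
rewrite -rhoZ// -subr_ge0 -(rhoB Bh)//; last first.
  by apply: single_genZ; exact: single_gen_id.
apply: rho_ge0.
  by apply: inD => //; exact: inZ.
move=> x; rewrite /= scaleN1r subr_ge0 phiE /GRing.scale /= /phi.
have := sqrtr_ge0 (f x); rewrite -/(h x) => hx.
by case: (leP (h x) d) => ?; nra.
Qed.

(** The limit [d -> 0]; it is applied with [c = rho (sqrt f)], which does not depend on [d]. *)
Lemma le_of_forall_linear (a b c : R) :
  (forall d, 0 < d -> a <= b + d * c) -> a <= b.
Proof.
move=> abc; apply/ler_addgt0Pr => e e0.
have c1 : 0 < `|c| + 1 by rewrite ltr_wpDl.
apply: (le_trans (abc (e / (`|c| + 1)) _)); first by rewrite divr_gt0.
rewrite lerD2l mulrAC ler_pdivrMr// ler_pM2l//.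
by rewrite (le_trans (ler_norm _))// lerDl.
Qed.

(** This replaces continuity of [rho] at [f], which is not yet available: cutting off the bottom of
    [f] costs an amount that vanishes with [d]. *)
Lemma rho_le_excess d f : 0 < d -> B f -> (forall x, 0 <= f x) ->
  rho f <= rho (excess (d ^+ 2) f) + d * rho (fun x => Num.sqrt (f x)).
Proof.
move=> d0 Bf f0; rewrite addrC (rho_trunc_excess Bf f0 (sqr_ge0 d)) lerD2r.
exact: rho_trunc_le (ltW d0) Bf f0.
Qed.

Lemma rho_excess_le_id d f : B f -> (forall x, 0 <= f x) ->
  rho (excess (d ^+ 2) f) <= rho f.
Proof.
move=> Bf f0; rewrite (rho_trunc_excess Bf f0 (sqr_ge0 d)) lerDr.
apply: rho_ge0; first by apply: in_trunc => //; exact: sqr_ge0.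
by move=> x; have [] := truncP (f0 x) (sqr_ge0 d).
Qed.

Lemma rho_mono f g : B f -> B g -> (forall x, 0 <= f x <= g x) ->
  rho f <= rho g.
Proof.
move=> Bf Bg fg.
have f0 x : 0 <= f x by have /andP[] := fg x.
apply: (@le_of_forall_linear _ _ (rho (fun x => Num.sqrt (f x)))) => d d0.
apply: (le_trans (rho_le_excess d0 Bf f0)); rewrite lerD2r.
by apply: rho_excess_le => //; rewrite exprn_gt0.
Qed.

(** * Positive and negative parts *)

Definition pospart f x := Num.max (f x) 0.
Definition negpart f x := Num.max (- f x) 0.

Lemma negpartE f : negpart f = pospart ((-1) \*: f).
Proof. by apply/funext => x; rewrite /negpart /pospart scale_funE mulN1r. Qed.

Lemma pospart_ge0 f x : 0 <= pospart f x.
Proof. by rewrite /pospart le_max lexx orbT. Qed.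

Lemma negpart_ge0 f x : 0 <= negpart f x.
Proof. by rewrite /negpart le_max lexx orbT. Qed.

Lemma pospart_le_norm f x : `|pospart f x| <= `|f x|.
Proof.
rewrite ger0_norm ?pospart_ge0// /pospart.
by case: (leP (f x) 0) => // ?; exact: ler_norm.
Qed.

Lemma negpart_le_norm f x : `|negpart f x| <= `|f x|.
Proof.
by rewrite negpartE (le_trans (pospart_le_norm _ _))// scale_funE mulN1r normrN.
Qed.

Lemma in_pospart f : B f -> B (pospart f).
Proof.
move=> Bf; apply: (in_le HB Bf); last exact: pospart_le_norm.
apply: continuous_maxr; last exact: continuous_cstr.
exact: Cc_or_C0_continuous HB Bf.
Qed.

Lemma in_negpart f : B f -> B (negpart f).
Proof. by move=> Bf; rewrite negpartE; apply: in_pospart; exact: inZ. Qed.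

Lemma rho_pospart_negpart f : B f ->
  rho f = rho (pospart f) - rho (negpart f).
Proof.
move=> Bf; have Sp : single_gen f (pospart f).
  apply: (@single_gen_comp _ _ (fun t => Num.max t 0)); last by rewrite maxxx.
  by apply: operates_max; [exact: operates_id|exact: operates_cst].
have Sn : single_gen f (negpart f).
  apply: (@single_gen_comp _ _ (fun t => Num.max (- t) 0)).
    apply: operates_max; last exact: operates_cst.
    have := operatesZ (-1) (@operates_id R X); congr operates.
    by apply/funext => t; rewrite mulN1r.
  by rewrite oppr0 maxxx.
rewrite -(rhoB Bf (in_negpart Bf) Sp Sn); congr rho.
apply/funext => x; rewrite /= scaleN1r /pospart /negpart.
by case: (leP (f x) 0) => ?; case: (leP (- f x) 0) => ?; lra.
Qed.

(** A difference of two nonnegative numbers is bounded by the larger one; this keeps the factor 2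
    out of the bound on [|rho f|]. *)
Lemma rho_norm_le_max f : B f ->
  `|rho f| <= Num.max (rho (pospart f)) (rho (negpart f)).
Proof.
move=> Bf; rewrite (rho_pospart_negpart Bf).
have p0 := rho_ge0 (in_pospart Bf) (pospart_ge0 f).
have n0 := rho_ge0 (in_negpart Bf) (negpart_ge0 f).
move: (rho _) (rho _) p0 n0 => p n p0 n0.
by rewrite ler_norml; case: (leP p n) => ?; apply/andP; split; lra.
Qed.

Lemma pospart_dist f g x : `|pospart f x - pospart g x| <= `|f x - g x|.
Proof.
rewrite /pospart.
case: (leP (f x) 0) => ?; case: (leP (g x) 0) => ?; rewrite ?subr0 ?sub0r.
- by rewrite normr0.
- by rewrite normrN gtr0_norm// ler_normr; apply/orP; right; lra.
- by rewrite gtr0_norm// ler_normr; apply/orP; left; lra.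
- by [].
Qed.

Lemma negpart_dist f g x : `|negpart f x - negpart g x| <= `|f x - g x|.
Proof.
rewrite !negpartE (le_trans (pospart_dist _ _ _))// !scale_funE.
by rewrite -mulrBr mulN1r normrN.
Qed.

(** The source of the factor 2 for signed functions: each term will be estimated by the nonnegative
    case. *)
Lemma rho_dist_parts f g : B f -> B g ->
  `|rho f - rho g| <= `|rho (pospart f) - rho (pospart g)| +
                      `|rho (negpart f) - rho (negpart g)|.
Proof.
move=> Bf Bg; rewrite (rho_pospart_negpart Bf) (rho_pospart_negpart Bg).
by rewrite opprB addrACA [_ + (_ - _)](_ : _ =
  (rho (pospart f) - rho (pospart g)) - (rho (negpart f) - rho (negpart g)));
  [exact: ler_normB|ring].
Qed.

End QuasiLinear.

(** * Lipschitz estimates in terms of [mu] *)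

Section Estimates.
Context {R : realType} {X : topologicalType}.
Hypotheses (lcX : locally_compact [set: X]) (hX : hausdorff_space X).
Variables (B : set (X -> R)) (rho : (X -> R) -> R).
Hypotheses (HB : Cc_or_C0 B) (Hrho : quasi_linear B rho).
Implicit Types (f g h v w : X -> R) (K U : set X).

Let inB f : Cc f -> B f. Proof. exact: Cc_sub. Qed.

Lemma Cc0 : Cc (cst 0 : X -> R).
Proof.
split; first exact: continuous_cstr.
rewrite (_ : fsupp _ = set0); first exact: compact0.
by rewrite -subset0; apply: fsupp_subP => [|x]; [exact: closed0|rewrite eqxx].
Qed.

Lemma mu_open_ub U w : Cc w -> (forall x, 0 <= w x <= 1) -> fsupp w `<=` U ->
  ((rho w)%:E <= mu_open rho U)%E.
Proof. by move=> *; apply: ereal_sup_ubound; exists w. Qed.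

Lemma mu_open_ge0 U : (0 <= mu_open rho U)%E.
Proof.
have -> : 0%E = (rho (cst 0))%:E by rewrite (rho0 Hrho (inB Cc0)).
apply: mu_open_ub; first exact: Cc0.
  by move=> x /=; rewrite lexx ler01.
by apply: subset_trans (sub0set U); apply: fsupp_subP => [|x];
  [exact: closed0|rewrite eqxx].
Qed.

(* If [0 <= g <= M] and [w = 1] on the support of [g], then [g] and [w] lie in
   the algebra generated by [g + M w]. *)
Lemma rho_add_plateau c g w : Cc g -> Cc w -> (forall x, 0 <= g x) ->
  (forall x, 0 <= w x <= 1) -> (forall x, g x != 0 -> w x = 1) ->
  rho (g \+ c \*: w) = rho g + c * rho w.
Proof.
move=> Cg Cw g0 w01 gw; have [M M0 gM] := C0_bounded (CcC0 Cg).
have [Bg Bw] := (inB Cg, inB Cw).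
have BMw : B (M \*: w) by exact: inZ.
have [|x|x|Sg Sw] := @plateau_single_gen _ _ M g (M \*: w) _ g0.
- exact: ltW.
- have /andP[w0 w1] := w01 x; rewrite scale_funE (mulr_ge0 (ltW M0) w0)/=.
  by rewrite -[leRHS]mulr1 ler_wpM2l// ltW.
- by move=> /gw wx; rewrite scale_funE wx mulr1.
have cwE : c \*: w = (c / M) \*: (M \*: w).
  by apply/funext => x; rewrite !scale_funE mulrA divfK// gt_eqF.
rewrite (rhoD Hrho (inD HB Bg BMw) Sg); last by rewrite cwE; exact: single_genZ.
by rewrite (rhoZ Hrho).
Qed.

Lemma rho_le_mu_open c f g K U : compact K -> open U -> K `<=` U ->
  Cc f -> Cc g -> (forall x, 0 <= f x) -> (forall x, 0 <= g x) ->
  fsupp f `<=` K -> fsupp g `<=` K -> 0 <= c -> (forall x, f x <= g x + c) ->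
  ((rho f - rho g)%:E <= c%:E * mu_open rho U)%E.
Proof.
move=> kK oU KU Cf Cg f0 g0 fK gK c0 fgc.
have [w [Cw w01 wK wU]] := @urysohn_Cc R _ lcX hX _ _ kK oU KU.
have le_rho : rho f <= rho (g \+ c \*: w).
  apply: (rho_mono HB Hrho); first exact: inB.
    by apply: (inD HB); [exact: inB|apply: (inZ _ HB); exact: inB].
  move=> x; rewrite f0 /= /GRing.scale /=.
  (* On [K] the term [c w] equals [c]; off [K] the function [f] vanishes. *)
  have [Kx|nKx] := pselect (K x); first by rewrite wK// mulr1.
  rewrite (@fsupp_out _ _ f x) => [|/fK//]; have /andP[w0 _] := w01 x.
  by rewrite addr_ge0// mulr_ge0.
rewrite rho_add_plateau// in le_rho; last first.
  by move=> x /sub_fsupp /gK /wK.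
apply: (@le_trans _ _ (c%:E * (rho w)%:E)%E).
  by rewrite -EFinM lee_fin lerBlDl.
by apply: lee_wpmul2l; [rewrite lee_fin|exact: mu_open_ub].
Qed.

Lemma rho_dist_mu_open c f g K U : compact K -> open U -> K `<=` U ->
  Cc f -> Cc g -> (forall x, 0 <= f x) -> (forall x, 0 <= g x) ->
  fsupp f `<=` K -> fsupp g `<=` K -> 0 <= c ->
  (forall x, `|f x - g x| <= c) ->
  (`|rho f - rho g|%:E <= c%:E * mu_open rho U)%E.
Proof.
move=> kK oU KU Cf Cg f0 g0 fK gK c0 fgc.
have [?|?] := ger0P (rho f - rho g).
  apply: (rho_le_mu_open kK) => // x.
  by have := fgc x; rewrite ler_norml => /andP[]; lra.
rewrite opprB; apply: (rho_le_mu_open kK) => // x.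
by have := fgc x; rewrite ler_norml => /andP[]; lra.
Qed.

Lemma rho_dist_mu c f g K : compact K ->
  Cc f -> Cc g -> (forall x, 0 <= f x) -> (forall x, 0 <= g x) ->
  fsupp f `<=` K -> fsupp g `<=` K -> 0 <= c ->
  (forall x, `|f x - g x| <= c) ->
  (`|rho f - rho g|%:E <= c%:E * mu rho K)%E.
Proof.
move=> kK Cf Cg f0 g0 fK gK; rewrite le_eqVlt => /predU1P[<-|c0] fgc.
  (* For [c = 0] the product is 0 even if the measure is infinite, so [K] may be exchanged for the
     whole space. *)
  rewrite mul0e -(mul0e (mu_open rho setT)).
  by apply: (rho_dist_mu_open kK) => //; exact: openT.
rewrite muE_closed; last exact: compact_closed.
(* Dividing by [c > 0] turns the claim into a lower bound for an infimum over open [U] containing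
   [K]. *)
rewrite -lee_pdivrMl//; apply: le_ereal_inf_tmp => _ [U [oU KU] <-].
by rewrite lee_pdivrMl//; apply: (rho_dist_mu_open kK) => //; exact: ltW.
Qed.

Lemma Cc_pospart f : Cc f -> Cc (pospart f).
Proof. by apply: in_pospart; left. Qed.

Lemma Cc_negpart f : Cc f -> Cc (negpart f).
Proof. by apply: in_negpart; left. Qed.

Lemma fsupp_le_norm f g : (forall x, `|f x| <= `|g x|) -> fsupp f `<=` fsupp g.
Proof.
move=> fg; apply: fsupp_subP => [|x fx]; first exact: closed_closure.
by apply: sub_fsupp; rewrite -normr_gt0 (lt_le_trans _ (fg x))// normr_gt0.
Qed.

Lemma fsupp_pospart f : fsupp (pospart f) `<=` fsupp f.
Proof. by apply: fsupp_le_norm; exact: pospart_le_norm. Qed.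

Lemma fsupp_negpart f : fsupp (negpart f) `<=` fsupp f.
Proof. by apply: fsupp_le_norm; exact: negpart_le_norm. Qed.

Lemma rho_dist_mu_signed c f g K : compact K -> Cc f -> Cc g ->
  fsupp f `<=` K -> fsupp g `<=` K -> 0 <= c ->
  (forall x, `|f x - g x| <= c) ->
  (`|rho f - rho g|%:E <= (2 * c)%:E * mu rho K)%E.
Proof.
move=> kK Cf Cg fK gK c0 fgc.
have := rho_dist_parts HB Hrho (inB Cf) (inB Cg); rewrite -lee_fin => /le_trans.
apply; rewrite mulr_natl mulr2n EFinD EFinD ge0_muleDl ?lee_fin//.
apply: leeD; apply: rho_dist_mu => //.
- exact: Cc_pospart.
- exact: Cc_pospart.
- exact: pospart_ge0.
- exact: pospart_ge0.
- exact: subset_trans (@fsupp_pospart f) fK.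
- exact: subset_trans (@fsupp_pospart g) gK.
- by move=> x; exact: le_trans (pospart_dist _ _ _) (fgc x).
- exact: Cc_negpart.
- exact: Cc_negpart.
- exact: negpart_ge0.
- exact: negpart_ge0.
- exact: subset_trans (@fsupp_negpart f) fK.
- exact: subset_trans (@fsupp_negpart g) gK.
- by move=> x; exact: le_trans (negpart_dist _ _ _) (fgc x).
Qed.

(** The nonnegative estimate compares each of [f^+] and [f^-] with 0, and only the larger of the two
    values counts. *)
Lemma rho_norm_mu c f K : compact K -> Cc f -> fsupp f `<=` K ->
  (forall x, `|f x| <= c) -> 0 <= c -> (`|rho f|%:E <= c%:E * mu rho K)%E.
Proof.
move=> kK Cf fK fc c0.
have supp0 : fsupp (cst 0 : X -> R) `<=` K.
  apply: subset_trans fK; apply: fsupp_le_norm => x.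
  by rewrite normr0 normr_ge0.
have bound g : Cc g -> (forall x, 0 <= g x) -> fsupp g `<=` fsupp f ->
    (forall x, `|g x| <= `|f x|) -> ((rho g)%:E <= c%:E * mu rho K)%E.
  move=> Cg g0 gf gle.
  have := @rho_dist_mu c g (cst 0) K kK Cg Cc0 g0 (fun=> lexx 0)
    (subset_trans gf fK) supp0 c0.
  rewrite (rho0 Hrho (inB Cc0)) subr0 ger0_norm//.
    by apply=> x; rewrite subr0 (le_trans (gle x)).
  exact: (rho_ge0 Hrho (inB Cg)).
have := rho_norm_le_max HB Hrho (inB Cf); rewrite -lee_fin => /le_trans; apply.
rewrite EFin_max ge_max; apply/andP; split; apply: bound.
- exact: Cc_pospart.
- exact: pospart_ge0.
- exact: fsupp_pospart.
- exact: pospart_le_norm.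
- exact: Cc_negpart.
- exact: negpart_ge0.
- exact: fsupp_negpart.
- exact: negpart_le_norm.
Qed.

Lemma mu_le_muT K : closed K -> (mu rho K <= mu rho setT)%E.
Proof.
move=> cK; rewrite muE_closed// muE_open; last exact: openT.
by apply: ereal_inf_lbound; exists setT => //; split => //; exact: openT.
Qed.

(** The point is [B = C0], where the norm is a supremum over more functions: each is approximated by
    its excesses over [d ^+ 2], which lie in [Cc]. *)
Lemma qnormE : qnorm B rho = mu rho setT.
Proof.
rewrite muE_open; last exact: openT.
apply/eqP; rewrite eq_le; apply/andP; split; last first.
  apply: ge_ereal_sup => _ [f [Cf f01 _] <-].
  by apply: ereal_sup_ubound; exists f => //; split=> //; exact: inB.
apply: ge_ereal_sup => _ [f [Bf /= f01] <-].
have f0 x : 0 <= f x by have /andP[] := f01 x.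
have ub d : 0 < d -> ((rho (excess (d ^+ 2) f))%:E <= mu_open rho setT)%E.
  move=> d0; apply: mu_open_ub => //.
    by apply: Cc_excess; [exact: (Cc_or_C0_sub HB)|rewrite exprn_gt0].
  move=> x; rewrite excess_ge0 (le_trans (excess_le (f0 x) (sqr_ge0 d)))//.
  by have /andP[] := f01 x.
case: (mu_open rho setT) (mu_open_ge0 setT) ub => [m|_ _|//]; last exact: leey.
move=> _ ub; rewrite lee_fin.
apply: (@le_of_forall_linear _ _ _ (rho (fun x => Num.sqrt (f x)))) => d d0.
apply: (le_trans (rho_le_excess HB Hrho d0 Bf f0)); rewrite lerD2r.
by rewrite -lee_fin ub.
Qed.

(** Without compact supports, the estimate is applied to the excesses of [f] and [g] over [d ^+ 2],
    with the whole space as open set. Passing back costs a vanishing term for [f] and nothing for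
    [g]. *)
Lemma rho_le_finite m c f g : mu rho setT = m%:E -> B f -> B g ->
  (forall x, 0 <= f x) -> (forall x, 0 <= g x) -> 0 <= c ->
  (forall x, `|f x - g x| <= c) -> rho f <= rho g + c * m.
Proof.
rewrite muE_open; last exact: openT.
move=> mE Bf Bg f0 g0 c0 fgc.
apply: (@le_of_forall_linear _ _ _ (rho (fun x => Num.sqrt (f x)))) => d d0.
apply: (le_trans (rho_le_excess HB Hrho d0 Bf f0)); rewrite lerD2r.
have Ce h : B h -> Cc (excess (d ^+ 2) h).
  move=> Bh; apply: Cc_excess; last by rewrite exprn_gt0.
  exact: (Cc_or_C0_sub HB).
have [[_ kf] [_ kg]] := (Ce f Bf, Ce g Bg).
have := @rho_dist_mu_open c _ _ _ setT (compactU kf kg) openT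
  (@subsetT _ _) (Ce f Bf) (Ce g Bg) (excess_ge0 _ f) (excess_ge0 _ g)
  (@subsetUl _ _ _) (@subsetUr _ _ _) c0.
rewrite mE -EFinM lee_fin ler_norml => dist.
have /andP[_ le1] :
    - (c * m) <= rho (excess (d ^+ 2) f) - rho (excess (d ^+ 2) g) <= c * m.
  apply: dist => x; apply: le_trans (fgc x).
  (* The excess is the positive part of [f - d ^+ 2], so cutting does not increase distances. *)
  have := pospart_dist (fun x => f x - d ^+ 2) (fun x => g x - d ^+ 2) x.
  by rewrite opprB addrA subrK.
have := rho_excess_le_id HB Hrho d Bg g0; lra.
Qed.

(** Serves uniform continuity on all of [B], including [C0]. *)
Lemma rho_dist_finite m c f g : mu rho setT = m%:E -> B f -> B g -> 0 <= c ->
  (forall x, `|f x - g x| <= c) -> `|rho f - rho g| <= 2 * m * c.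
Proof.
move=> mE Bf Bg c0 fgc.
have dist h k : B h -> B k -> (forall x, 0 <= h x) -> (forall x, 0 <= k x) ->
    (forall x, `|h x - k x| <= `|f x - g x|) -> `|rho h - rho k| <= c * m.
  move=> Bh Bk h0 k0 hk.
  have hkc x : `|h x - k x| <= c by exact: le_trans (hk x) (fgc x).
  have khc x : `|k x - h x| <= c by rewrite distrC.
  have := rho_le_finite mE Bh Bk h0 k0 c0 hkc.
  have := rho_le_finite mE Bk Bh k0 h0 c0 khc.
  by rewrite ler_norml => *; apply/andP; split; lra.
have d1 := dist _ _ (in_pospart HB Bf) (in_pospart HB Bg) (pospart_ge0 f)
  (pospart_ge0 g) (pospart_dist f g).
have d2 := dist _ _ (in_negpart HB Bf) (in_negpart HB Bg) (negpart_ge0 f)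
  (negpart_ge0 g) (negpart_dist f g).
by have := rho_dist_parts HB Hrho Bf Bg; lra.
Qed.

End Estimates.

(** * From Lipschitz bounds to continuity *)

Lemma lipschitz_unif_continuous_on (R : realType) (X : topologicalType)
    (B : set (X -> R)) (rho : (X -> R) -> R) (C : R) :
  (forall c f g, B f -> B g -> 0 <= c -> (forall x, `|f x - g x| <= c) ->
    `|rho f - rho g| <= C * c) ->
  unif_continuous_on B rho.
Proof.
move=> lip E; rewrite /= -entourage_ballE => -[e /= e0 sE].
have C1 : 0 < `|C| + 1 by rewrite ltr_wpDl.
pose d := e / (`|C| + 1).
have d0 : 0 < d by rewrite divr_gt0.
exists [set fg : {uniform X -> R} * {uniform X -> R} |
    forall x, `|fg.1 x - fg.2 x| < d].
  rewrite uniform_entourage; exists [set ab : R * R | `|ab.1 - ab.2| < d].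
    by rewrite -entourage_ballE; exists d.
  by move=> [f g] /= fg x; exact: fg.
(* Close pairs in the subspace uniformity are equal pairs or close pairs in [B]. *)
move=> [f g] /= [->|[Bf [Bg fg]]]; apply: sE; first exact: ballxx.
rewrite /ball /= (le_lt_trans (lip d f g Bf Bg (ltW d0) _))//.
  by move=> x; exact: ltW.
rewrite /d mulrCA -[ltRHS]mulr1 ltr_pM2l// ltr_pdivrMr// mul1r.
by rewrite (le_lt_trans (ler_norm C))// ltrDl.
Qed.

Lemma lipschitz_continuous_uc_compact (R : realType) (X : topologicalType)
    (rho : (X -> R) -> R) :
  (forall K, compact K -> exists C, forall c f g, Cc f -> Cc g ->
    fsupp f `<=` K -> fsupp g `<=` K -> 0 <= c ->
    (forall x, `|f x - g x| <= c) -> `|rho f - rho g| <= C * c) ->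
  continuous_uc_compact rho.
Proof.
move=> lip K kK; have [C lipC] := lip K kK.
apply/subspace_continuousP => f [Cf fK] W /=.
rewrite -nbhs_ballE => -[e /= e0 sW].
have C1 : 0 < `|C| + 1 by rewrite ltr_wpDl.
pose d := e / (`|C| + 1).
have d0 : 0 < d by rewrite divr_gt0.
have entd : entourage [set ab : R * R | `|ab.1 - ab.2| < d].
  by rewrite -entourage_ballE; exists d.
apply: filterS (@fam_nbhs X R compact K _ f entd kK) => g /= fg [Cg gK].
apply: sW; rewrite /ball /= (le_lt_trans (lipC d f g Cf Cg fK gK (ltW d0) _))//.
  (* Both functions vanish off [K], so closeness on [K] is closeness everywhere. *)
  move=> x; have [Kx|nKx] := pselect (K x); first exact/ltW/fg.
  rewrite (@fsupp_out _ _ f) => [|/fK//].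
  rewrite (@fsupp_out _ _ g) => [|/gK//].
  by rewrite subrr normr0 ltW.
rewrite /d mulrCA -[ltRHS]mulr1 ltr_pM2l// ltr_pdivrMr// mul1r.
by rewrite (le_lt_trans (ler_norm C))// ltrDl.
Qed.

(** * Compact spaces, where constants belong to every [S(f)] *)

Section CompactCase.
Context {R : realType} {X : topologicalType}.
Hypothesis kX : compact [set: X].
Variable rho : (X -> R) -> R.
Hypothesis Hrho : quasi_linear [set f : X -> R | continuous f] rho.
Implicit Types (f g : X -> R) (c : R).

Let HB : Cc_or_C0 [set f : X -> R | continuous f].
Proof. by left; rewrite compact_CcE. Qed.

Lemma rho_cst c : rho (cst c) = c * rho (cst 1).
Proof.
rewrite -(rhoZ Hrho) /=; last exact: continuous_cstr.
by congr rho; apply/funext => x; rewrite scale_funE mulr1.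
Qed.

Lemma rho_add_cst f c : continuous f -> rho (f \+ cst c) = rho f + rho (cst c).
Proof.
move=> cf; apply: (rhoD Hrho cf); first exact: single_gen_id.
exact: single_gen_cst.
Qed.

(** Adding a constant bound of [|f|] makes both functions nonnegative, and [rho] splits the constant
    off again. *)
Lemma rho_mono_compact f g : continuous f -> continuous g ->
  (forall x, f x <= g x) -> rho f <= rho g.
Proof.
move=> cf cg fg; have := cf; rewrite -[continuous f]/([set f | continuous f] f).
rewrite -compact_CcE// => /CcC0/C0_bounded[M M0 fM].
have addc (h : X -> R) : continuous h -> continuous (h \+ cst M).
  by move=> ch; apply: (continuousDr ch); exact: continuous_cstr.
have : rho (f \+ cst M) <= rho (g \+ cst M).
  apply: (rho_mono HB Hrho); [exact: addc|exact: addc|] => x /=.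
  rewrite lerD2r fg andbT; have := fM x; rewrite ler_norml => /andP[+ _]; lra.
by rewrite !rho_add_cst// lerD2r.
Qed.

(** Monotonicity now covers signed functions, so no splitting into parts and no factor 2 occurs. *)
Lemma rho_dist_compact c f g : continuous f -> continuous g ->
  (forall x, `|f x - g x| <= c) -> `|rho f - rho g| <= rho (cst c).
Proof.
move=> cf cg fgc.
have addc (h : X -> R) : continuous h -> continuous (h \+ cst c).
  by move=> ch; apply: (continuousDr ch); exact: continuous_cstr.
have le1 : rho f <= rho (g \+ cst c).
  apply: rho_mono_compact => //; first exact: addc.
  by move=> x /=; have := fgc x; rewrite ler_norml => /andP[]; lra.
have le2 : rho g <= rho (f \+ cst c).
  apply: rho_mono_compact => //; first exact: addc.
  by move=> x /=; have := fgc x; rewrite ler_norml => /andP[]; lra.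
rewrite !rho_add_cst// in le1 le2.
by rewrite ler_norml; apply/andP; split; lra.
Qed.

(** Here [g = c - f] lies in [S(f)]. *)
Lemma rho_add_eq_cst f g c : continuous f -> f \+ g = cst c ->
  rho f + rho g = rho (cst c).
Proof.
move=> cf fgc; rewrite -fgc; apply/esym/(rhoD Hrho cf).
  exact: single_gen_id.
have -> : g = cst c \+ (-1) \*: f.
  by rewrite -fgc; apply/funext => x; rewrite /= scaleN1r addrAC subrr add0r.
apply: single_genD; first exact: single_gen_cst.
by apply: single_genZ; exact: single_gen_id.
Qed.

End CompactCase.

(** * Assembly of the estimates, with [c] taken as the uniform norm *)

Theorem theorem47 (R : realType) (X : topologicalType)
    (lcX : locally_compact [set: X]) (hX : hausdorff_space X)
    (cX : connected [set: X]) :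
  (forall (B : set (X -> R)) (rho : (X -> R) -> R),
    B = Cc \/ B = C0 -> quasi_linear B rho ->
    (* (i) *)
    (compact_finite (mu rho) ->
      [/\ forall (f g : X -> R) (K : set X), compact K -> Cc f -> Cc g ->
            (forall x, 0 <= f x) -> (forall x, 0 <= g x) ->
            fsupp f `<=` K -> fsupp g `<=` K ->
            (`|rho f - rho g|%:E <= (unorm (f \- g))%:E * mu rho K)%E,
          forall f : X -> R, Cc f ->
            (`|rho f|%:E <= (unorm f)%:E * mu rho (fsupp f))%E,
          forall (f g : X -> R) (K : set X), compact K -> Cc f -> Cc g ->
            fsupp f `<=` K -> fsupp g `<=` K ->
            (`|rho f - rho g|%:E <= (2 * unorm (f \- g))%:E * mu rho K)%E &
          continuous_uc_compact rho]) /\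
    (* (ii) *)
    ((mu rho [set: X] < +oo)%E <-> (qnorm B rho < +oo)%E) /\
    ((mu rho [set: X] < +oo)%E ->
      [/\ forall f : X -> R, Cc f ->
            (`|rho f|%:E <= (unorm f)%:E * mu rho [set: X])%E /\
            ((unorm f)%:E * mu rho [set: X] = (unorm f)%:E * qnorm B rho)%E,
          forall f g : X -> R, Cc f -> Cc g ->
            (forall x, 0 <= f x) -> (forall x, 0 <= g x) ->
            (`|rho f - rho g|%:E <= (unorm (f \- g))%:E * mu rho [set: X])%E /\
            ((unorm (f \- g))%:E * mu rho [set: X] =
             (unorm (f \- g))%:E * qnorm B rho)%E,
          forall f g : X -> R, Cc f -> Cc g ->
            (`|rho f - rho g|%:E <=
             (2 * unorm (f \- g))%:E * mu rho [set: X])%E /\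
            ((2 * unorm (f \- g))%:E * mu rho [set: X] =
             (2 * unorm (f \- g))%:E * qnorm B rho)%E &
          unif_continuous_on B rho])) /\
  (* (iii) *)
  (compact [set: X] ->
    forall rho : (X -> R) -> R,
    quasi_linear [set f : X -> R | continuous f] rho ->
    [/\ forall f g : X -> R, continuous f -> continuous g ->
          `|rho f - rho g| <= rho (cst (unorm (f \- g))) /\
          rho (cst (unorm (f \- g))) = unorm (f \- g) * rho (cst 1),
        unif_continuous_on [set f : X -> R | continuous f] rho &
        forall (f g : X -> R) (c : R), continuous f -> continuous g ->
          f \+ g = cst c -> rho f + rho g = rho (cst c)]).
Proof.
have bnd (f g : X -> R) : C0 f -> C0 g ->
    forall x, `|f x - g x| <= unorm (f \- g).
  by move=> Cf Cg x; apply: (@unorm_ub _ _ (f \- g)); exact: C0_sub_bounded.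
have u0 (h : X -> R) : 0 <= unorm h by exact: unorm_ge0.
split; first (move=> B rho HB Hrho; split; last split).
- move=> fin.
  have cdist (f g : X -> R) K : compact K -> Cc f -> Cc g -> fsupp f `<=` K ->
      fsupp g `<=` K ->
      (`|rho f - rho g|%:E <= (2 * unorm (f \- g))%:E * mu rho K)%E.
    move=> kK Cf Cg fK gK; apply: (rho_dist_mu_signed lcX hX HB Hrho) => //.
    by apply: bnd; exact: CcC0.
  split=> //.
  + move=> f g K kK Cf Cg f0 g0 fK gK.
    apply: (rho_dist_mu lcX hX HB Hrho) => //.
    by apply: bnd; exact: CcC0.
  + move=> f Cf; apply: (rho_norm_mu lcX hX HB Hrho) => //.
      by have [] := Cf.
    by move=> x; apply: unorm_ub; apply: C0_bounded; exact: CcC0.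
  + apply: lipschitz_continuous_uc_compact => K kK.
    have muK0 : (0 <= mu rho K)%E.
      rewrite muE_closed; last exact: compact_closed.
      by apply: le_ereal_inf_tmp => _ [U _ <-]; exact: (mu_open_ge0 HB Hrho).
    (* Finite and nonnegative, [mu rho K] is a real [m], and [2 * m] is a Lipschitz constant. *)
    have := fin K kK; case E : (mu rho K) muK0 => [m| |]//= _ _.
    exists (2 * m) => c f g Cf Cg fK gK c0 fgc.
    have := rho_dist_mu_signed lcX hX HB Hrho kK Cf Cg fK gK c0 fgc.
    by rewrite E -EFinM lee_fin mulrAC.
- by rewrite (qnormE HB Hrho).
- move=> fin; have muT0 : (0 <= mu rho setT)%E.
    by rewrite muE_open; [exact: (mu_open_ge0 HB Hrho)|exact: openT].
  rewrite (qnormE HB Hrho).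
  (* The bounds on [X] come from those on a compact set that contains the supports. *)
  have muT K c (r : R) : compact K -> 0 <= c -> (r%:E <= c%:E * mu rho K)%E ->
      (r%:E <= c%:E * mu rho setT)%E.
    move=> kK c0 /le_trans; apply; apply: lee_wpmul2l; first by rewrite lee_fin.
    by apply: mu_le_muT; exact: compact_closed.
  split.
  + move=> f Cf; split=> //; have [_ kf] := Cf.
    apply: (muT _ _ _ kf) => //; apply: (rho_norm_mu lcX hX HB Hrho) => //.
    by move=> x; apply: unorm_ub; apply: C0_bounded; exact: CcC0.
  + move=> f g Cf Cg f0 g0; split=> //; have [[_ kf] [_ kg]] := (Cf, Cg).
    apply: (muT _ _ _ (compactU kf kg)) => //.
    apply: (rho_dist_mu lcX hX HB Hrho) => //; first exact: compactU.
    by apply: bnd; exact: CcC0.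
  + move=> f g Cf Cg; split=> //; have [[_ kf] [_ kg]] := (Cf, Cg).
    apply: (muT _ _ _ (compactU kf kg)); first by rewrite mulr_ge0.
    apply: (rho_dist_mu_signed lcX hX HB Hrho) => //; first exact: compactU.
    by apply: bnd; exact: CcC0.
  + case E : (mu rho setT) fin muT0 => [m| |]//= _ _.
    apply: (@lipschitz_unif_continuous_on _ _ _ _ (2 * m)).
    move=> c f g Bf Bg c0 fgc.
    exact: (rho_dist_finite lcX hX HB Hrho E).
- move=> kX rho Hrho.
  have inC0 (f : X -> R) : continuous f -> C0 f.
    by move=> cf; apply: CcC0; rewrite compact_CcE.
  split.
  + move=> f g cf cg; split; last exact: (rho_cst Hrho).
    by apply: (rho_dist_compact kX Hrho) => //; apply: bnd; exact: inC0.
  + apply: (@lipschitz_unif_continuous_on _ _ _ _ (rho (cst 1))).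
    move=> c f g cf cg _ fgc; rewrite mulrC -(rho_cst Hrho).
    exact: (rho_dist_compact kX Hrho).
  + by move=> f g c cf _; exact: (rho_add_eq_cst kX Hrho).
Qed.
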